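(* Let $H$ be a Hilbert space over $\mathbf K\in\{\mathbb R,\mathbb C\}$ and let $\mathcal S$ be the normed algebra of all finite rank bounded operators on $H$. The normal category $\mathscr L(\mathcal S)$ of principal left ideals of $\mathcal S$ is isomorphic, as a normal category, to the normal category $\mathscr R(\mathcal S)$ of principal right ideals of $\mathcal S$, via an isomorphism sending $\mathcal SP_M$ to $P_M\mathcal S$. Moreover, for all finite-dimensional subspaces $M$ and $N$ of $H$, this isomorphism restricts to a conjugate-linear isometry from the hom-set $\mathscr L(\mathcal S)(\mathcal SP_M,\mathcal SP_N)$ onto the hom-set $\mathscr R(\mathcal S)(P_M\mathcal S,P_N\mathcal S)$.
   Context: Composition convention: operators and morphisms are composed left to right, i.e. $(T_1T_2)(x)=T_2(T_1(x))$, and $fg$ means first $f$, then $g$. $\mathcal S$ carries the operator norm. For a finite-dimensional subspace $M$ of $H$, $P_M$ is the orthogonal projection of $H$ onto $M$. Category $\mathscr L(\mathcal S)$: objects are the principal left ideals $\mathcal SP=\{AP:A\in\mathcal S\}$ with $P\in\mathcal S$ idempotent; every object equals $\mathcal SP_M$ for a unique finite-dimensional subspace $M$ of $H$. Morphisms $\mathcal SP_1\to\mathcal SP_2$ are the maps $\rho(P_1,T,P_2):A\mapsto AT$ for $T\in P_1\mathcal SP_2$. Inclusions are the set inclusions. Hom-sets are normed spaces with $\rho(P_M,T_1,P_N)+\rho(P_M,T_2,P_N)=\rho(P_M,T_1+T_2,P_N)$, $k\rho(P_M,T,P_N)=\rho(P_M,kT,P_N)$, $\|\rho(P_M,T,P_N)\|=\|T\|$.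 Category $\mathscr R(\mathcal S)$: objects are the principal right ideals $P\mathcal S=\{PA:A\in\mathcal S\}$ with $P\in\mathcal S$ idempotent; every object equals $P_M\mathcal S$ for a unique finite-dimensional subspace $M$ of $H$. Morphisms $P_M\mathcal S\to P_N\mathcal S$ are the maps $\lambda(P_M,T,P_N):A\mapsto TA$ for $T\in P_N\mathcal SP_M$. Inclusions are the set inclusions. Hom-sets are normed spaces with $\lambda(P_M,T_1,P_N)+\lambda(P_M,T_2,P_N)=\lambda(P_M,T_1+T_2,P_N)$, $k\lambda(P_M,T,P_N)=\lambda(P_M,kT,P_N)$, $\|\lambda(P_M,T,P_N)\|=\|T\|$. A category with subobjects is a small category $\mathscr C$ with a subcategory $\mathscr P$ having the same objects, such that $\mathscr P$ is a strict preorder (at most one morphism between any two objects, and the relation ''there is a morphism $p\to p'$'' is a partial order), every morphism of $\mathscr P$ (called an inclusion) is a monomorphism in $\mathscr C$, and if $f=hg$ with $f,g\in\mathscr P$, $h\in\mathscr C$, then $h\in\mathscr P$. A retraction is a morphism $q$ with $jq=1$ for some inclusion $j$. A normal factorization of $f$ is $f=quj$ with $q$ a retraction, $u$ an isomorphism, $j$ an inclusion. A cone $\gamma$ with vertex $d$ assigns to each object $c$ a morphism $\gamma(c):c\to d$ with $j\gamma(c)=\gamma(c')$ for every inclusion $j:c'\to c$; it is normal if some $\gamma(c)$ is an isomorphism. A normal category is a category with subobjects in which every morphism has a normal factorization, every inclusion splits (has a retraction), and for each object $d$ there is a normal cone $\gamma$ with vertex $d$ and $\gamma(d)=1_d$.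 Two normal categories are isomorphic if there are mutually inverse inclusion-preserving functors between them. *)

(* Defs.v *)
From HB Require Import structures.
From mathcomp Require Import all_boot all_order all_algebra.
From mathcomp Require Import all_classical all_reals all_analysis.
From mathcomp Require Import complex.

Set Implicit Arguments.
Unset Strict Implicit.
Unset Printing Implicit Defensive.

Import Order.TTheory GRing.Theory Num.Theory.
Import numFieldNormedType.Exports.

Local Open Scope classical_set_scope.
Local Open Scope ring_scope.

(* Composition is written in diagrammatic order: [comp f g] is first [f], then
   [g]. *)
Record category := Category {
  obj :> Type ;
  hom : obj -> obj -> Type ;
  idm : forall a, hom a a ;
  comp : forall a b c, hom a b -> hom b c -> hom a c ;
  comp1m : forall a b (f : hom a b), comp (idm a) f = f ;
  compm1 : forall a b (f : hom a b), comp f (idm b) = f ;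
  compmA : forall a b c d (f : hom a b) (g : hom b c) (h : hom c d),
    comp f (comp g h) = comp (comp f g) h
}.
Arguments hom {_} _ _.
Arguments idm {_} _.
Arguments comp {_ _ _ _} _ _.

Definition monomorphism (C : category) (a b : C) (f : hom a b) :=
  forall c (g h : hom c a), comp g f = comp h f -> g = h.

Definition isomorphism (C : category) (a b : C) (f : hom a b) :=
  exists g : hom b a, comp f g = idm a /\ comp g f = idm b.

(* The subcategory of inclusions has all the objects of the category, hence is
   given by a predicate [incl] on morphisms. *)
Record subobjCategory := SubobjCategory {
  subobj_category :> category ;
  incl : forall a b : subobj_category, hom a b -> Prop ;
  incl_id : forall a, incl (idm a) ;
  incl_comp : forall a b c (f : hom a b) (g : hom b c),
    incl f -> incl g -> incl (comp f g) ;
  incl_unique : forall a b (f g : hom a b), incl f -> incl g -> f = g ;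
  incl_antisym : forall a b (f : hom a b) (g : hom b a),
    incl f -> incl g -> a = b ;
  incl_mono : forall a b (f : hom a b), incl f -> monomorphism f ;
  incl_left : forall a b c (h : hom a b) (g : hom b c),
    incl (comp h g) -> incl g -> incl h
}.
Arguments incl {_ _ _} _.

Section NormalNotions.
Variable C : subobjCategory.

Definition retraction (a b : C) (q : hom a b) :=
  exists j : hom b a, incl j /\ comp j q = idm b.

Definition normal_factorization (a b : C) (f : hom a b) :=
  exists (a' b' : C) (q : hom a a') (u : hom a' b') (j : hom b' b),
    [/\ retraction q, isomorphism u, incl j & f = comp (comp q u) j].

Definition splits (a b : C) (j : hom a b) :=
  exists q : hom b a, comp j q = idm a.

Definition cone (d : C) (gamma : forall c : C, hom c d) :=
  forall (c' c : C) (j : hom c' c), incl j -> comp j (gamma c) = gamma c'.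

Definition normal_cone (d : C) (gamma : forall c : C, hom c d) :=
  cone gamma /\ exists c, isomorphism (gamma c).

End NormalNotions.

Record normalCategory := NormalCategory {
  normal_category :> subobjCategory ;
  normal_factorizationP : forall (a b : normal_category) (f : hom a b),
    normal_factorization f ;
  incl_splits : forall (a b : normal_category) (j : hom a b),
    incl j -> splits j ;
  normal_coneP : forall d : normal_category,
    exists gamma : forall c, hom c d, normal_cone gamma /\ gamma d = idm d
}.

Record functor (C D : category) := Functor {
  fobj :> C -> D ;
  functor_hom : forall a b : C, hom a b -> hom (fobj a) (fobj b) ;
  functor_id : forall a, functor_hom (idm a) = idm (fobj a) ;
  functor_comp : forall a b c (f : hom a b) (g : hom b c),
    functor_hom (comp f g) = comp (functor_hom f) (functor_hom g)
}.
Arguments functor_hom {C D} _ {a b} _.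

Definition inclusion_preserving (C D : subobjCategory) (F : functor C D) :=
  forall (a b : C) (j : hom a b), incl j -> incl (functor_hom F j).

(* A morphism packed with its domain and codomain, so that morphisms between
   provably equal objects can be compared. *)
Definition arrow (C : category) (a b : C) (f : hom a b) :
    {ab : C * C & hom ab.1 ab.2} :=
  existT (fun ab : C * C => hom ab.1 ab.2) (a, b) f.

(* [F] followed by [G] is the identity functor, on morphisms and (taking
   identity morphisms for [f]) on objects. *)
Definition functor_left_inverse (C D : category) (F : functor C D) (G : functor D C) :=
  forall (a b : C) (f : hom a b), arrow (functor_hom G (functor_hom F f)) = arrow f.

Record normalIso (C D : normalCategory) := NormalIso {
  iso_fun :> functor C D ;
  iso_inv : functor D C ;
  iso_fun_incl : inclusion_preserving iso_fun ;
  iso_inv_incl : inclusion_preserving iso_inv ;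
  iso_funK : functor_left_inverse iso_fun iso_inv ;
  iso_invK : functor_left_inverse iso_inv iso_fun
}.

Definition cast_hom (C : category) (a a' b b' : C) (ea : a = a') (eb : b = b') :
    hom a b -> hom a' b' :=
  match ea, eb with erefl, erefl => fun f => f end.

Section PrincipalIdeals.
Local Open Scope group_scope.
Variable S : semigroupType.
Implicit Types P Q T : S.

Definition idempotent_elt P := P * P = P.

Definition regular_semigroup := forall T, exists T', T * T' * T = T.

Definition left_ideal P : set S := [set A * P | A in [set: S]].
Definition right_ideal P : set S := [set P * A | A in [set: S]].
Definition corner P Q : set S := [set P * A * Q | A in [set: S]].

Lemma left_idealP P (A : S) : idempotent_elt P -> left_ideal P A <-> A * P = A.
Proof.
move=> hP; split=> [[B _ <-]|<-]; first by rewrite -mulgA hP.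
by exists A.
Qed.

Lemma right_idealP P (A : S) : idempotent_elt P -> right_ideal P A <-> P * A = A.
Proof.
move=> hP; split=> [[B _ <-]|<-]; first by rewrite mulgA hP.
by exists A.
Qed.

Lemma cornerP P Q T : idempotent_elt P -> idempotent_elt Q ->
  corner P Q T <-> P * T = T /\ T * Q = T.
Proof.
move=> hP hQ; split=> [[A _ <-]|[h1 h2]]; first by rewrite !mulgA hP -!mulgA hQ.
by exists T => //; rewrite h1 h2.
Qed.

Lemma left_idealK P (hP : idempotent_elt P) (A : left_ideal P) :
  sval A * P = sval A.
Proof. by case: A => A /= /set_mem /left_idealP; apply. Qed.

Lemma right_idealK P (hP : idempotent_elt P) (A : right_ideal P) :
  P * sval A = sval A.
Proof. by case: A => A /= /set_mem /right_idealP; apply. Qed.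

Record lideal := LIdeal {
  lideal_set :> set S ;
  lideal_principal :
    exists P, idempotent_elt P /\ lideal_set = left_ideal P
}.

Record rideal := RIdeal {
  rideal_set :> set S ;
  rideal_principal :
    exists P, idempotent_elt P /\ rideal_set = right_ideal P
}.

Lemma lideal_eq (I J : lideal) : I = J :> set S -> I = J.
Proof.
case: I J => [I hI] [J hJ] /= e; case: J / e hJ => hJ.
by congr LIdeal; exact: Prop_irrelevance.
Qed.

Lemma rideal_eq (I J : rideal) : I = J :> set S -> I = J.
Proof.
case: I J => [I hI] [J hJ] /= e; case: J / e hJ => hJ.
by congr RIdeal; exact: Prop_irrelevance.
Qed.

Definition principal_lideal P (hP : idempotent_elt P) : lideal :=
  LIdeal (ex_intro _ P (conj hP erefl)).

Definition principal_rideal P (hP : idempotent_elt P) : rideal :=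
  RIdeal (ex_intro _ P (conj hP erefl)).

(* The idempotents [P] and [Q] generating [I] and [J] are not unique, and
   neither is [T]; only the map [A |-> A T] matters. *)
Record lhom (I J : lideal) := LHom {
  lhom_fun :> I -> J ;
  lhom_rho : exists P T Q,
    [/\ idempotent_elt P /\ idempotent_elt Q,
        I = left_ideal P :> set S, J = left_ideal Q :> set S, corner P Q T
      & forall A : I, sval (lhom_fun A) = sval A * T]
}.

Record rhom (I J : rideal) := RHom {
  rhom_fun :> I -> J ;
  rhom_lambda : exists P T Q,
    [/\ idempotent_elt P /\ idempotent_elt Q,
        I = right_ideal P :> set S, J = right_ideal Q :> set S, corner Q P T
      & forall A : I, sval (rhom_fun A) = T * sval A]
}.

Lemma lhom_eq I J (f g : lhom I J) :
  (forall A : I, sval (f A) = sval (g A)) -> f = g.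
Proof.
case: f g => [f hf] [g hg] /= e.
have {}e : f = g by apply/funext => A; apply: val_inj; exact: e.
by case: g / e hg => hg; congr LHom; exact: Prop_irrelevance.
Qed.

Lemma rhom_eq I J (f g : rhom I J) :
  (forall A : I, sval (f A) = sval (g A)) -> f = g.
Proof.
case: f g => [f hf] [g hg] /= e.
have {}e : f = g by apply/funext => A; apply: val_inj; exact: e.
by case: g / e hg => hg; congr RHom; exact: Prop_irrelevance.
Qed.

Section Rho.
Variables (I J : lideal) (P Q : S).
Hypotheses (hP : idempotent_elt P) (hQ : idempotent_elt Q).
Hypotheses (hI : I = left_ideal P :> set S) (hJ : J = left_ideal Q :> set S).
Variables (T : S) (hT : corner P Q T).

Lemma rho_subproof (A : I) : sval A * T \in (J : set S).
Proof.
rewrite inE hJ; apply/left_idealP => //.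
by have [_ e] := (cornerP T hP hQ).1 hT; rewrite -mulgA e.
Qed.

Definition rho : lhom I J.
Proof.
exists (fun A : I => SigSub (rho_subproof A)).
by exists P, T, Q; split.
Defined.

End Rho.

Section Lambda.
Variables (I J : rideal) (P Q : S).
Hypotheses (hP : idempotent_elt P) (hQ : idempotent_elt Q).
Hypotheses (hI : I = right_ideal P :> set S) (hJ : J = right_ideal Q :> set S).
Variables (T : S) (hT : corner Q P T).

Lemma lambda_subproof (A : I) : T * sval A \in (J : set S).
Proof.
rewrite inE hJ; apply/right_idealP => //.
by have [e _] := (cornerP T hQ hP).1 hT; rewrite mulgA e.
Qed.

Definition lambda : rhom I J.
Proof.
exists (fun A : I => SigSub (lambda_subproof A)).
by exists P, T, Q; split.
Defined.

End Lambda.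

Lemma lideal_mem (I : lideal) P (hP : idempotent_elt P) (A : I) :
  I = left_ideal P :> set S -> sval A * P = sval A.
Proof. by move=> hI; case: A => A /= /set_mem; rewrite hI => /left_idealP; apply. Qed.

Lemma rideal_mem (I : rideal) P (hP : idempotent_elt P) (A : I) :
  I = right_ideal P :> set S -> P * sval A = sval A.
Proof. by move=> hI; case: A => A /= /set_mem; rewrite hI => /right_idealP; apply. Qed.

Definition lhom_id (I : lideal) : lhom I I.
Proof.
exists id; have [P [hP hI]] := lideal_principal I.
exists P, P, P; split => //; first by apply/cornerP.
by move=> A; rewrite (lideal_mem hP).
Defined.

Definition rhom_id (I : rideal) : rhom I I.
Proof.
exists id; have [P [hP hI]] := rideal_principal I.
exists P, P, P; split => //; first by apply/cornerP.
by move=> A; rewrite (rideal_mem hP).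
Defined.

Definition lhom_comp (I J K : lideal) (f : lhom I J) (g : lhom J K) : lhom I K.
Proof.
exists (g \o f).
have [P [T [Q [[hP hQ] hI _ hT fE]]]] := lhom_rho f.
have [P' [T' [Q' [[hP' hQ'] _ hK hT' gE]]]] := lhom_rho g.
exists P, (T * T'), Q'; split => //.
  apply/cornerP => //.
  have [e _] := (cornerP T hP hQ).1 hT; have [_ e'] := (cornerP T' hP' hQ').1 hT'.
  by rewrite mulgA e -mulgA e'.
by move=> A /=; rewrite gE fE mulgA.
Defined.

Definition rhom_comp (I J K : rideal) (f : rhom I J) (g : rhom J K) : rhom I K.
Proof.
exists (g \o f).
have [P [T [Q [[hP hQ] hI _ hT fE]]]] := rhom_lambda f.
have [P' [T' [Q' [[hP' hQ'] _ hK hT' gE]]]] := rhom_lambda g.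
exists P, (T' * T), Q'; split => //.
  apply/cornerP => //.
  have [_ e] := (cornerP T hQ hP).1 hT; have [e' _] := (cornerP T' hQ' hP').1 hT'.
  by rewrite mulgA e' -mulgA e.
by move=> A /=; rewrite gE fE mulgA.
Defined.

Definition lideal_category : category.
Proof.
by refine (@Category lideal lhom lhom_id lhom_comp _ _ _) => *; exact: lhom_eq.
Defined.

Definition rideal_category : category.
Proof.
by refine (@Category rideal rhom rhom_id rhom_comp _ _ _) => *; exact: rhom_eq.
Defined.

Definition lincl (I J : lideal_category) (f : hom I J) :=
  forall A : (I : lideal), sval ((f : lhom I J) A) = sval A.

Definition rincl (I J : rideal_category) (f : hom I J) :=
  forall A : (I : rideal), sval ((f : rhom I J) A) = sval A.

Lemma lincl_subset (I J : lideal_category) (f : hom I J) : lincl f ->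
  lideal_set I `<=` lideal_set J.
Proof.
move=> hf A IA; have /set_mem := valP ((f : lhom I J) (SigSub (mem_set IA))).
by rewrite /= hf.
Qed.

Lemma rincl_subset (I J : rideal_category) (f : hom I J) : rincl f ->
  rideal_set I `<=` rideal_set J.
Proof.
move=> hf A IA; have /set_mem := valP ((f : rhom I J) (SigSub (mem_set IA))).
by rewrite /= hf.
Qed.

Definition lideal_subobjCategory : subobjCategory.
Proof.
refine (@SubobjCategory lideal_category lincl _ _ _ _ _ _).
- by move=> I A.
- by move=> I J K f g hf hg A /=; rewrite hg hf.
- by move=> I J f g hf hg; apply: lhom_eq => A; rewrite hf hg.
- by move=> I J f g hf hg; apply: lideal_eq; apply/seteqP; split;
    [exact: lincl_subset hf|exact: lincl_subset hg].
- move=> I J f hf K g h e; apply: lhom_eq => A; rewrite -hf -[RHS]hf.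
  exact: (congr1 (fun u : lhom K J => sval (u A)) e).
- by move=> I J K h g hhg hg A; rewrite -hg; exact: hhg.
Defined.

Definition rideal_subobjCategory : subobjCategory.
Proof.
refine (@SubobjCategory rideal_category rincl _ _ _ _ _ _).
- by move=> I A.
- by move=> I J K f g hf hg A /=; rewrite hg hf.
- by move=> I J f g hf hg; apply: rhom_eq => A; rewrite hf hg.
- by move=> I J f g hf hg; apply: rideal_eq; apply/seteqP; split;
    [exact: rincl_subset hf|exact: rincl_subset hg].
- move=> I J f hf K g h e; apply: rhom_eq => A; rewrite -hf -[RHS]hf.
  exact: (congr1 (fun u : rhom K J => sval (u A)) e).
- by move=> I J K h g hhg hg A; rewrite -hg; exact: hhg.
Defined.

Lemma regular_pinverse P Q T : regular_semigroup ->
  idempotent_elt P -> idempotent_elt Q -> corner P Q T ->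
  exists U, T * U * T = T /\ U * T * U = U.
Proof.
move=> reg hP hQ /(cornerP T hP hQ)[PT TQ]; have [V hV] := reg T.
exists (V * T * V); split; first by rewrite !mulgA hV hV.
by rewrite -!mulgA; congr (_ * _); rewrite !mulgA hV hV.
Qed.

Section Regular.
Hypothesis reg : regular_semigroup.

Lemma lideal_normal_factorization (I J : lideal_subobjCategory) (f : hom I J) :
  normal_factorization f.
Proof.
have [P [T [Q [[hP hQ] hI hJ hT fE]]]] := lhom_rho f.
have [PT TQ] := (cornerP T hP hQ).1 hT.
have [V [TVT VTV]] := regular_pinverse reg hP hQ hT.
pose U := V * P.
have UP : U * P = U by rewrite /U -mulgA hP.
have TUT : T * U * T = T by rewrite /U !mulgA -[_ * P * T]mulgA PT TVT.
have UTU : U * T * U = U by rewrite /U -[V * P * T]mulgA PT mulgA VTV.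
move: U UP TUT UTU => {V TVT VTV} U UP TUT UTU.
have hE : idempotent_elt (T * U) by rewrite /idempotent_elt mulgA TUT.
have hF : idempotent_elt (U * T) by rewrite /idempotent_elt mulgA UTU.
pose K : lideal_subobjCategory := principal_lideal hE.
pose L : lideal_subobjCategory := principal_lideal hF.
have c1 : corner P (T * U) (T * U) by apply/cornerP => //; split; [by rewrite mulgA PT|exact: hE].
have c2 : corner (T * U) (U * T) T by apply/cornerP => //; split; [by rewrite TUT|by rewrite mulgA TUT].
have c3 : corner (U * T) Q (U * T) by apply/cornerP => //; split; [exact: hF|by rewrite -mulgA TQ].
have c4 : corner (T * U) P (T * U) by apply/cornerP => //; split; [exact: hE|by rewrite -mulgA UP].
have c5 : corner (U * T) (T * U) U by apply/cornerP => //; split; [by rewrite UTU|by rewrite mulgA UTU].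
have KE := erefl (left_ideal (T * U)); have LE := erefl (left_ideal (U * T)).
exists K, L, (rho hP hE hI (J := K) KE c1), (rho hE hF (I := K) (J := L) KE LE c2),
  (rho hF hQ (I := L) LE hJ c3); split.
- exists (rho hE hP (I := K) KE hI c4); split.
    by move=> A; exact: (left_idealK hE).
  by apply: lhom_eq => A /=; rewrite !(left_idealK hE).
- exists (rho hF hE (I := L) (J := K) LE KE c5); split; apply: lhom_eq => A /=.
    by rewrite -mulgA (left_idealK hE).
  by rewrite -mulgA (left_idealK hF).
- by move=> A; exact: (left_idealK hF).
- apply: lhom_eq => A; rewrite fE /= -!mulgA; congr (_ * _).
  by rewrite !mulgA TUT TUT.
Qed.

Lemma rideal_normal_factorization (I J : rideal_subobjCategory) (f : hom I J) :
  normal_factorization f.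
Proof.
have [P [T [Q [[hP hQ] hI hJ hT fE]]]] := rhom_lambda f.
have [QT TP] := (cornerP T hQ hP).1 hT.
have [V [TVT VTV]] := regular_pinverse reg hQ hP hT.
pose U := P * V.
have PU : P * U = U by rewrite /U mulgA hP.
have TUT : T * U * T = T by rewrite /U !mulgA TP TVT.
have UTU : U * T * U = U by rewrite /U -!mulgA [T * (P * V)]mulgA TP mulgA !mulgA -[P * V * T]mulgA -mulgA VTV.
move: U PU TUT UTU => {V TVT VTV} U PU TUT UTU.
have hE : idempotent_elt (U * T) by rewrite /idempotent_elt mulgA UTU.
have hF : idempotent_elt (T * U) by rewrite /idempotent_elt mulgA TUT.
pose K : rideal_subobjCategory := principal_rideal hE.
pose L : rideal_subobjCategory := principal_rideal hF.
have c1 : corner (U * T) P (U * T) by apply/cornerP => //; split; [exact: hE|by rewrite -mulgA TP].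
have c2 : corner (T * U) (U * T) T by apply/cornerP => //; split; [by rewrite TUT|by rewrite mulgA TUT].
have c3 : corner Q (T * U) (T * U) by apply/cornerP => //; split; [by rewrite mulgA QT|exact: hF].
have c4 : corner P (U * T) (U * T) by apply/cornerP => //; split; [by rewrite mulgA PU|exact: hE].
have c5 : corner (U * T) (T * U) U by apply/cornerP => //; split; [by rewrite UTU|by rewrite mulgA UTU].
have KE := erefl (right_ideal (U * T)); have LE := erefl (right_ideal (T * U)).
exists K, L, (lambda hP hE hI (J := K) KE c1),
  (lambda hE hF (I := K) (J := L) KE LE c2),
  (lambda hF hQ (I := L) LE hJ c3); split.
- exists (lambda hE hP (I := K) KE hI c4); split.
    by move=> A; exact: (right_idealK hE).
  by apply: rhom_eq => A /=; rewrite !(right_idealK hE).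
- exists (lambda hF hE (I := L) (J := K) LE KE c5); split; apply: rhom_eq => A /=.
    by rewrite mulgA (right_idealK hE).
  by rewrite mulgA (right_idealK hF).
- by move=> A; exact: (right_idealK hF).
- by apply: rhom_eq => A; rewrite fE /= !mulgA TUT TUT.
Qed.

Definition lideal_normalCategory : normalCategory.
Proof.
refine (@NormalCategory lideal_subobjCategory lideal_normal_factorization _ _).
- move=> I J j hj.
  have [P [hP hI]] := lideal_principal I; have [Q [hQ hJ]] := lideal_principal J.
  have c : corner Q P (Q * P).
    by apply/cornerP => //; split; [rewrite mulgA hQ|rewrite -mulgA hP].
  exists (rho hQ hP hJ hI c); apply: lhom_eq => A /=; rewrite mulgA.
  by rewrite (lideal_mem hQ) // hj (lideal_mem hP).
- move=> J; have [Q [hQ hJ]] := lideal_principal J.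
  pose P (I : lideal) := projT1 (cid (lideal_principal I)).
  have hP (I : lideal) : idempotent_elt (P I) := (projT2 (cid (lideal_principal I))).1.
  have hI (I : lideal) : I = left_ideal (P I) :> set S := (projT2 (cid (lideal_principal I))).2.
  have c (I : lideal) : corner (P I) Q (P I * Q).
    by apply/cornerP => //; split; [rewrite mulgA hP|rewrite -mulgA hQ].
  pose gamma (I : lideal_subobjCategory) : hom I J := rho (hP I) hQ (hI I) hJ (c I).
  have gammaE I (A : (I : lideal)) : sval ((gamma I : lhom I J) A) = sval A * Q.
    by rewrite /= mulgA (lideal_mem (hP I)).
  have gammaJ : gamma J = idm J.
    by apply: lhom_eq => A; rewrite gammaE (lideal_mem hQ).
  exists gamma; split=> //; split.
    move=> I' I j hj; apply: lhom_eq => A.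
    by rewrite gammaE [LHS]gammaE hj.
  by exists J; rewrite gammaJ; exists (idm J); split; rewrite comp1m.
Defined.

Definition rideal_normalCategory : normalCategory.
Proof.
refine (@NormalCategory rideal_subobjCategory rideal_normal_factorization _ _).
- move=> I J j hj.
  have [P [hP hI]] := rideal_principal I; have [Q [hQ hJ]] := rideal_principal J.
  have c : corner P Q (P * Q).
    by apply/cornerP => //; split; [rewrite mulgA hP|rewrite -mulgA hQ].
  exists (lambda hQ hP hJ hI c); apply: rhom_eq => A /=; rewrite -mulgA.
  by rewrite (rideal_mem hQ) // hj (rideal_mem hP).
- move=> J; have [Q [hQ hJ]] := rideal_principal J.
  pose P (I : rideal) := projT1 (cid (rideal_principal I)).
  have hP (I : rideal) : idempotent_elt (P I) := (projT2 (cid (rideal_principal I))).1.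
  have hI (I : rideal) : I = right_ideal (P I) :> set S := (projT2 (cid (rideal_principal I))).2.
  have c (I : rideal) : corner Q (P I) (Q * P I).
    by apply/cornerP => //; split; [rewrite mulgA hQ|rewrite -mulgA hP].
  pose gamma (I : rideal_subobjCategory) : hom I J :=
    lambda (hP I) hQ (hI I) hJ (c I).
  have gammaE I (A : (I : rideal)) : sval ((gamma I : rhom I J) A) = Q * sval A.
    by rewrite /= -mulgA (rideal_mem (hP I)).
  have gammaJ : gamma J = idm J.
    by apply: rhom_eq => A; rewrite gammaE (rideal_mem hQ).
  exists gamma; split=> //; split.
    move=> I' I j hj; apply: rhom_eq => A.
    by rewrite gammaE [LHS]gammaE hj.
  by exists J; rewrite gammaJ; exists (idm J); split; rewrite comp1m.
Defined.

End Regular.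

End PrincipalIdeals.

Variant scalarKind := RealScalars | ComplexScalars.

Section Scalars.
Variables (R : realType) (k : scalarKind).

Definition scalarField : numFieldType :=
  match k with RealScalars => R | ComplexScalars => R[i] end.

Definition sconj : {rmorphism scalarField -> scalarField} :=
  match k as k0 return
    let K : numFieldType :=
      match k0 with RealScalars => R | ComplexScalars => R[i] end in
    {rmorphism K -> K}
  with RealScalars => idfun | ComplexScalars => Num.conj end.

(* Norms of elements of a [scalarField]-normed space are nonnegative elements of
   [scalarField]; [sre] reads them as elements of [R]. *)
Definition sre : scalarField -> R :=
  match k as k0 return
    (match k0 with RealScalars => R | ComplexScalars => R[i] end : numFieldType)
      -> R
  with RealScalars => id | ComplexScalars => @complex.Re R end.

End Scalars.
Arguments sconj {R k}.
Arguments sre {R k}.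

Lemma sconjK R k : involutive (@sconj R k).
Proof. by case: k => //= x; rewrite conjCK. Qed.

Lemma normsM R k (a : scalarField R k) : `|a| ^+ 2 = a * sconj a.
Proof.
by case: k a => /= a; [rewrite real_normK ?num_real // expr2|rewrite normCK].
Qed.

Lemma sre0 R k : @sre R k 0 = 0.
Proof. by case: k. Qed.

Lemma sre1 R k : @sre R k 1 = 1.
Proof. by case: k. Qed.

Lemma sreD R k : {morph @sre R k : x y / x + y}.
Proof. by case: k => //= -[a b] [c d]. Qed.

Lemma sre_nat R k n : @sre R k n%:R = n%:R.
Proof. by elim: n => [|n IH]; rewrite ?sre0 // -addn1 !natrD sreD IH sre1. Qed.

Lemma sreN R k : {morph @sre R k : x / - x}.
Proof. by case: k => //= -[a b]. Qed.

Lemma ler_sre R k : {homo @sre R k : x y / x <= y}.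
Proof. by case: k => //= -[a b] [c d]; rewrite lecE => /andP[]. Qed.

Lemma ler_sre_ge0 R k (x y : scalarField R k) : 0 <= x -> 0 <= y ->
  (sre x <= sre y) = (x <= y).
Proof.
case: k x y => //= -[a b] [c d]; rewrite !lecE /= => /andP[/eqP -> _] /andP[/eqP -> _].
by rewrite eqxx.
Qed.

Lemma sreM_ge0 R k (x y : scalarField R k) : 0 <= x ->
  sre (x * y) = sre x * sre y.
Proof.
case: k x y => //= -[a b] [c d]; rewrite lecE /= => /andP[/eqP -> _].
by rewrite mul0r subr0.
Qed.

Record hilbertSpace (R : realType) (k : scalarKind) := HilbertSpace {
  hilbert_carrier :> completeNormedModType (scalarField R k) ;
  inner : {dot hilbert_carrier for @sconj R k} ;
  inner_norm : forall x, `|x| ^+ 2 = inner x x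
}.

Section FiniteRank.
Variables (R : realType) (k : scalarKind) (H : hilbertSpace R k).
Local Notation K := (scalarField R k).
Local Notation "''[' x , y ]" := (inner H x y).

Definition span (s : seq H) : set H :=
  [set x | exists c : 'I_(size s) -> K, x = \sum_i c i *: s`_i].

Definition finite_dimensional (M : set H) := exists s, M = span s.

Record fdSubspace := FdSubspace {
  fd_set :> set H ;
  fd_finite_dimensional : finite_dimensional fd_set
}.

Definition finite_rank : {pred H -> H} :=
  [pred T | `[< [/\ linear T, continuous T & finite_dimensional (range T)] >]].

Record finop := FinOp {
  finop_fun :> H -> H ;
  finop_rank : finop_fun \in finite_rank
}.
HB.instance Definition _ := [isSub for finop_fun].
HB.instance Definition _ := [Choice of finop by <:].

Lemma span0 s : span s 0.
Proof. by exists (fun=> 0); rewrite big1 // => i _; rewrite scale0r. Qed.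

Lemma spanP s a x y : span s x -> span s y -> span s (a *: x + y).
Proof.
move=> [c ->] [d ->]; exists (fun i => a * c i + d i).
rewrite scaler_sumr -big_split; apply: eq_bigr => i _ /=.
by rewrite scalerDl scalerA.
Qed.

Lemma spanZ s a x : span s x -> span s (a *: x).
Proof. by move=> h; rewrite -[_ *: x]addr0; apply: spanP => //; exact: span0. Qed.

Lemma spanD s x y : span s x -> span s y -> span s (x + y).
Proof. by move=> hx; rewrite -[x]scale1r; exact: spanP. Qed.

Lemma spanB s x y : span s x -> span s y -> span s (x - y).
Proof. by move=> hx hy; rewrite addrC -scaleN1r; exact: spanP. Qed.

Lemma span_nil : span [::] = [set 0].
Proof.
apply/seteqP; split=> [x [c ->]|x ->]; last exact: span0.
by rewrite big_ord0.
Qed.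

Lemma span_cons v s x : span (v :: s) x <-> exists a y, span s y /\ x = a *: v + y.
Proof.
split=> [[c ->]|[a [_ [[c ->] ->]]]].
  exists (c ord0), (\sum_i c (lift ord0 i) *: s`_i); split; last first.
    by rewrite big_ord_recl.
  by exists (fun i => c (lift ord0 i)).
exists (fun i => if unlift ord0 i is Some j then c j else a).
rewrite big_ord_recl unlift_none; congr (_ + _).
by apply: eq_bigr => i _; rewrite liftK.
Qed.

Lemma findim_sub (s : seq H) (V : set H) : V 0 ->
  (forall a x y, V x -> V y -> V (a *: x + y)) -> V `<=` span s ->
  finite_dimensional V.
Proof.
elim: s V => [|v s IH] V V0 Vlin Vs.
  exists [::]; rewrite span_nil; apply/seteqP; split=> [x /Vs|_ -> //].
  by rewrite span_nil.
have [|||t Vt] := IH (V `&` span s).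
- by split=> //; exact: span0.
- by move=> a x y [Vx sx] [Vy sy]; split; [exact: Vlin|exact: spanP].
- by move=> x [].
have [Vsub|/existsNP[w /not_implyP[Vw nsw]]] := pselect (V `<=` span s).
  by exists t; rewrite -Vt; apply/seteqP; split=> [x Vx|x []//]; split=> //; exact: Vsub.
have [c [u [su wE]]] := (span_cons _ _ _).1 (Vs _ Vw).
have c0 : c != 0.
  by apply/eqP => c0; apply: nsw; rewrite wE c0 scale0r add0r.
exists (w :: t); apply/seteqP; split=> x.
  move=> Vx; apply/span_cons.
  have [a [y [sy xE]]] := (span_cons _ _ _).1 (Vs _ Vx).
  exists (a / c), (x - (a / c) *: w); split; last by rewrite addrC subrK.
  rewrite -Vt; split; first by rewrite addrC -scaleNr; exact: Vlin.
  rewrite xE wE scalerDr scalerA divfK // opprD addrACA subrr add0r.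
  by apply: spanB => //; exact: spanZ.
move=> /span_cons[a [y [ty ->]]]; apply: Vlin => //.
by move: ty; rewrite -Vt => -[].
Qed.

Lemma range_lin (T : H -> H) : linear T ->
  range T 0 /\ (forall a x y, range T x -> range T y -> range T (a *: x + y)).
Proof.
move=> lT; split.
  by exists 0 => //; have := lT (-1) 0 0; rewrite scaler0 addr0 scaleN1r addNr.
by move=> a _ _ [x _ <-] [y _ <-]; exists (a *: x + y); rewrite ?lT.
Qed.

Lemma finite_rankP (T : H -> H) s : linear T -> continuous T ->
  range T `<=` span s -> T \in finite_rank.
Proof.
move=> lT cT Ts; rewrite inE; split => //.
by have [? ?] := range_lin lT; exact: findim_sub Ts.
Qed.

Lemma finopP (T : finop) :
  [/\ linear T, continuous T & finite_dimensional (range T)].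
Proof. by have := finop_rank T; rewrite inE. Qed.

HB.instance Definition _ (T : finop) :=
  GRing.isLinear.Build K H H _ T (let: And3 h _ _ := finopP T in h).

Lemma span_cat s t x y : span s x -> span t y -> span (s ++ t) (x + y).
Proof.
elim: s x => [|v s IH] x.
  by rewrite span_nil => ->; rewrite add0r.
move=> /span_cons[a [z [sz ->]]] ty /=; apply/span_cons.
by exists a, (z + y); split; [exact: IH|rewrite addrA].
Qed.

Lemma finite_rank_submod : submod_closed finite_rank.
Proof.
split.
  apply: (@finite_rankP _ [::]).
  - by move=> a x y; rewrite scaler0 addr0.
  - by move=> x; apply: cst_continuous.
  - by move=> _ [x _ <-]; exact: span0.
move=> a f g; rewrite inE => -[lf cf [s fs]]; rewrite inE => -[lg cg [t gt]].
apply: (@finite_rankP _ (s ++ t)).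
- move=> b x y.
  have E z : (a *: f + g) z = a *: f z + g z by [].
  by rewrite !E lf lg !scalerDr !scalerA addrACA [a * b]mulrC.
- by move=> x; apply: cvgD; [apply: cvgZl_tmp; exact: cf|exact: cg].
- move=> _ [x _ <-]; apply: span_cat.
    by apply: spanZ; rewrite -fs; exists x.
  by rewrite -gt; exists x.
Qed.
HB.instance Definition _ :=
  GRing.isSubmodClosed.Build K (H -> H) finite_rank finite_rank_submod.
HB.instance Definition _ := [SubChoice_isSubLmodule of finop by <:].

Lemma finop_eq (S T : finop) : S =1 T -> S = T.
Proof. by move=> e; apply: val_inj; apply/funext => x; exact: e. Qed.

Lemma opmul_subproof (S T : finop) : (S \; T : H -> H) \in finite_rank.
Proof.
have [lT cT [t tE]] := finopP T.
apply: (@finite_rankP _ t).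
- by move=> a x y; rewrite /= !linearP.
- by have [_ cS _] := finopP S; move=> x; apply: continuous_comp; [exact: cS|exact: cT].
- by move=> _ [x _ <-]; rewrite -tE; exists (S x).
Qed.

(* Operators compose from left to right: [S * T] is first [S], then [T]. *)
Definition opmul (S T : finop) : finop := FinOp (opmul_subproof S T).

Lemma opmulA : associative opmul.
Proof. by move=> S T U; exact: finop_eq. Qed.
HB.instance Definition _ := isSemigroup.Build finop opmulA.

Lemma innerC (x y : H) : '[x, y] = sconj '[y, x].
Proof. by rewrite hermC expr0 mul1r. Qed.

Lemma inner_ge0 (x : H) : 0 <= '[x, x].
Proof. by rewrite -inner_norm exprn_ge0. Qed.

Lemma inner_eq0 (x : H) : '[x, x] = 0 -> x = 0.
Proof. by move/eqP; rewrite -inner_norm expf_eq0 normr_eq0 => /andP[_ /eqP]. Qed.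

Lemma innerZl a (x y : H) : '[a *: x, y] = a * '[x, y].
Proof. exact: linearZl_LR. Qed.

Lemma innerZr a (x y : H) : '[x, a *: y] = sconj a * '[x, y].
Proof. exact: linearZr_LR. Qed.

Lemma CauchySchwarz (x y : H) : `|'[x, y]| <= `|x| * `|y|.
Proof.
have [->|y0] := eqVneq y 0; first by rewrite linear0r !normr0 mulr0.
have yy : 0 < '[y, y].
  by rewrite lt_neqAle inner_ge0 andbT eq_sym; apply: contra_neq y0; exact: inner_eq0.
rewrite -(@ler_pXn2r _ 2) ?nnegrE ?mulr_ge0 //.
rewrite exprMn !inner_norm normsM -ler_pdivrMr //.
pose a := '[x, y] / '[y, y]; pose u := x - a *: y.
have uy : '[u, y] = 0.
  by rewrite linearBl /= innerZl divfK ?subrr // gt_eqF.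
have := inner_ge0 u; rewrite {2}/u linearBr /= innerZr uy mulr0 subr0.
rewrite linearBl /= innerZl subr_ge0 [in '[y, x]]innerC.
by rewrite /a mulrAC.
Qed.

Definition rank1_fun (w z : H) : H -> H := fun x => '[x, w] *: z.

Lemma rank1_subproof w z : rank1_fun w z \in finite_rank.
Proof.
have lin : linear (rank1_fun w z).
  by move=> a x y; rewrite /rank1_fun linearPl scalerDl scalerA.
apply: (@finite_rankP _ [:: z]) => //.
- pose L := GRing.isLinear.Build K H H _ (rank1_fun w z) lin.
  pose f : {linear H -> H} := HB.pack (rank1_fun w z) L.
  apply: (@bounded_linear_continuous _ _ _ f); apply/bounded_funP => r.
  exists (r * (`|w| * `|z|)) => x xr; rewrite /= /rank1_fun normrZ mulrA.
  apply: ler_wpM2r => //; apply: le_trans (CauchySchwarz _ _) _.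
  exact: ler_wpM2r.
- move=> _ [x _ <-]; apply/span_cons; exists '[x, w], 0; rewrite addr0.
  by split=> //; exact: span0.
Qed.

Definition rank1 w z : finop := FinOp (rank1_subproof w z).

Definition orthogonal_projection (M : set H) (P : finop) :=
  forall x, M (P x) /\ forall y, M y -> '[x - P x, y] = 0.

Lemma orthogonal_projection_fix s P y : orthogonal_projection (span s) P ->
  span s y -> P y = y.
Proof.
move=> hP sy; have [sPy h] := hP y.
by apply/esym/eqP; rewrite -subr_eq0; apply/eqP/inner_eq0/h; exact: spanB.
Qed.

(* Gram-Schmidt, keeping track of a partial inverse of [T]. *)
Lemma gram_schmidt (T : H -> H) s : linear T -> span s `<=` range T ->
  exists P U : finop, orthogonal_projection (span s) P /\ forall x, T (U x) = P x.
Proof.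
move=> lT; have T0 : T 0 = 0.
  by have := lT (-1) 0 0; rewrite scaler0 addr0 scaleN1r addNr.
elim: s => [_|v s IH sT].
  exists 0, 0; split=> [x|x]; last exact: T0.
  by rewrite span_nil; split=> // y ->; exact: linear0r.
have [|P [U [hP hU]]] := IH.
  by move=> y sy; apply: sT; apply/span_cons; exists 0, y; rewrite scale0r add0r.
have [|z _ zE] := sT v.
  by apply/span_cons; exists 1, 0; rewrite scale1r addr0; split=> //; exact: span0.
pose w := v - P v.
have ws y : span s y -> '[w, y] = 0 by exact: (hP v).2.
have sw y : span s y -> '[y, w] = 0 by move=> sy; rewrite innerC ws ?rmorph0.
exists (P + '[w, w]^-1 *: rank1 w w), (U + '[w, w]^-1 *: rank1 w (z - U v)).
pose c x := '[w, w]^-1 * '[x, w].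
have E x : (P + '[w, w]^-1 *: rank1 w w) x = c x *: w + P x.
  by rewrite addrC -scalerA.
have E' x : (U + '[w, w]^-1 *: rank1 w (z - U v)) x = c x *: (z - U v) + U x.
  by rewrite addrC -scalerA.
split=> x; last first.
  rewrite E E' lT hU; congr (c x *: _ + _).
  by rewrite addrC -scaleN1r lT scaleN1r hU zE addrC.
rewrite E; split.
  apply/span_cons; exists (c x), (P x - c x *: P v); split.
    by apply: spanB; [exact: (hP x).1|apply: spanZ; exact: (hP v).1].
  by rewrite /w scalerBr addrAC -addrA.
have h y : span s y -> '[x - (c x *: w + P x), y] = 0.
  move=> sy; rewrite opprD addrCA linearDl /= (hP x).2 // addr0.
  by rewrite linearNl /= innerZl ws // mulr0 oppr0.
have hw : '[x - (c x *: w + P x), w] = 0.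
  rewrite opprD addrA linearBl linearBl /= innerZl (sw _ (hP x).1) subr0 /c /=.
  have [w0|w0] := eqVneq w 0; first by rewrite w0 !linear0r subrr.
  rewrite mulrAC mulVf ?mul1r ?subrr //.
  by apply: contra_neq w0; exact: inner_eq0.
move=> y /span_cons[a [u [su ->]]].
have -> : a *: v + u = a *: w + (a *: P v + u).
  by rewrite /w scalerBr addrA subrK.
rewrite linearDr /= innerZr hw mulr0 add0r; apply: h.
by apply: spanP => //; exact: (hP v).1.
Qed.

Lemma finop_regular : regular_semigroup finop.
Proof.
move=> T; have [lT cT [s sE]] := finopP T.
have [|P [U [hP hU]]] := gram_schmidt lT (s := s); first by rewrite sE.
exists U; apply: finop_eq => x /=; rewrite hU; apply: (orthogonal_projection_fix hP).
by rewrite -sE; exists x.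
Qed.

Lemma orthogonal_projection_exists (M : fdSubspace) :
  exists P, orthogonal_projection M P.
Proof.
have [s ->] := fd_finite_dimensional M.
have [||P [_ [? _]]] := @gram_schmidt id s; last by exists P.
- by [].
- by move=> x _; exists x.
Qed.

Definition proj (M : fdSubspace) : finop :=
  projT1 (cid (orthogonal_projection_exists M)).

Lemma projP (M : fdSubspace) : orthogonal_projection M (proj M).
Proof. exact: projT2 (cid (orthogonal_projection_exists M)). Qed.

Lemma proj_idem (M : fdSubspace) : idempotent_elt (proj M).
Proof.
apply: finop_eq => x /=; have := projP M; have [s -> hP] := fd_finite_dimensional M.
by apply: (orthogonal_projection_fix hP); have [] := hP x.
Qed.

Definition opnorm (T : finop) : R :=
  sup [set sre `|T x| | x in [set x : H | `|x| <= 1]].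

Lemma opnorm_has_sup (T : finop) :
  has_sup [set sre `|T x| | x in [set x : H | `|x| <= 1]].
Proof.
split; first by exists (sre `|T 0|); exists 0 => //=; rewrite normr0.
have [_ cT _] := finopP T.
have /bounded_funP/(_ 1)[B hB] : bounded_near T (nbhs (0 : H)).
  exact/linear_bounded_continuous.
by exists (sre B) => _ [x /= x1 <-]; apply: ler_sre; exact: hB.
Qed.

Lemma opnorm_ub (T : finop) (x : H) : `|x| <= 1 -> sre `|T x| <= opnorm T.
Proof. by move=> x1; apply: ub_le_sup; [exact: (opnorm_has_sup T).2|exists x]. Qed.

Lemma opnorm_le (T : finop) (B : R) :
  (forall x : H, `|x| <= 1 -> sre `|T x| <= B) -> opnorm T <= B.
Proof.
move=> h; apply: ge_sup; first exact: (opnorm_has_sup T).1.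
by move=> _ [x x1 <-]; exact: h.
Qed.

Lemma opnormD (S T : finop) : opnorm (S + T) <= opnorm S + opnorm T.
Proof.
apply: opnorm_le => x x1.
apply: (@le_trans _ _ (sre (`|S x| + `|T x|))).
  by apply: ler_sre; exact: ler_normD.
by rewrite sreD lerD // opnorm_ub.
Qed.

Lemma opnorm_eq0 (T : finop) : opnorm T = 0 -> T = 0.
Proof.
move=> T0; apply: finop_eq => x.
have h (y : H) : `|y| <= 1 -> T y = 0.
  move=> y1; apply/eqP; rewrite -normr_eq0 eq_le normr_ge0 andbT.
  by rewrite -ler_sre_ge0 // sre0 -T0; exact: opnorm_ub.
have [->|x0] := eqVneq x 0; first by rewrite linear0.
have nx : `|x| != 0 by rewrite normr_eq0.
rewrite -[x]scale1r -(divff nx) -scalerA linearZ /= h ?scaler0 //.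
by rewrite normrZ normfV normr_id mulVf.
Qed.

Lemma opnormZ (a : K) (T : finop) : opnorm (a *: T) = sre `|a| * opnorm T.
Proof.
have le (b : K) (U : finop) : opnorm (b *: U) <= sre `|b| * opnorm U.
  apply: opnorm_le => x x1.
  have -> : `|(b *: U) x| = `|b| * `|U x| by exact: normrZ.
  rewrite sreM_ge0 //; apply: ler_wpM2l; last exact: opnorm_ub.
  by rewrite -(sre0 R k); exact: ler_sre.
apply/eqP; rewrite eq_le le /=.
have [->|a0] := eqVneq a 0.
  rewrite normr0 sre0 mul0r; apply: le_trans (opnorm_ub _ (x := 0) _).
    by rewrite -(sre0 R k); apply: ler_sre.
  by rewrite normr0.
have := le a^-1 (a *: T); rewrite scalerA mulVf // scale1r => h.
have na : 0 <= sre `|a| by rewrite -(sre0 R k); exact: ler_sre.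
apply: le_trans (ler_wpM2l na h) _.
by rewrite mulrA -sreM_ge0 // -normrM divff // normr1 sre1 mul1r.
Qed.

Lemma opnormMn (T : finop) n : opnorm (T *+ n) = opnorm T *+ n.
Proof. by rewrite -scaler_nat opnormZ normr_nat sre_nat mulr_natl. Qed.

Lemma opnormN (T : finop) : opnorm (- T) = opnorm T.
Proof. by rewrite -scaleN1r opnormZ normrN1 sre1 mul1r. Qed.

HB.instance Definition _ :=
  Num.Zmodule_isNormed.Build R finop opnormD opnorm_eq0 opnormMn opnormN.

Definition left_ideals : normalCategory := lideal_normalCategory finop_regular.
Definition right_ideals : normalCategory := rideal_normalCategory finop_regular.

Definition left_ideal_proj (M : fdSubspace) : left_ideals :=
  principal_lideal (proj_idem M).
Definition right_ideal_proj (M : fdSubspace) : right_ideals :=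
  principal_rideal (proj_idem M).

Definition left_hom (M N : fdSubspace) : Type :=
  hom (left_ideal_proj M) (left_ideal_proj N).
Definition right_hom (M N : fdSubspace) : Type :=
  hom (right_ideal_proj M) (right_ideal_proj N).

HB.instance Definition _ M N := gen_eqMixin (left_hom M N).
HB.instance Definition _ M N := gen_choiceMixin (left_hom M N).
HB.instance Definition _ M N := gen_eqMixin (right_hom M N).
HB.instance Definition _ M N := gen_choiceMixin (right_hom M N).

Lemma opmulDl (S T U : finop) : ((S + T)%R * U)%g = (S * U)%g + (T * U)%g.
Proof. by apply: finop_eq => x; exact: linearD. Qed.

Lemma opmulZl a (S U : finop) : ((a *: S)%R * U)%g = a *: (S * U)%g.
Proof. by apply: finop_eq => x; exact: linearZ. Qed.

Lemma opmulDr (S T U : finop) : (U * (S + T)%R)%g = (U * S)%g + (U * T)%g.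
Proof. exact: finop_eq. Qed.

Lemma opmulZr a (S U : finop) : (U * (a *: S)%R)%g = a *: (U * S)%g.
Proof. exact: finop_eq. Qed.

Section HomSpace.
Variables M N : fdSubspace.
Local Notation P := (proj M).
Local Notation Q := (proj N).

Lemma cornerD (P' Q' S T : finop) :
  corner P' Q' S -> corner P' Q' T -> corner P' Q' (S + T).
Proof.
by move=> [A _ <-] [B _ <-]; exists (A + B) => //; rewrite opmulDr opmulDl.
Qed.

Lemma cornerZ (P' Q' T : finop) a : corner P' Q' T -> corner P' Q' (a *: T).
Proof. by move=> [A _ <-]; exists (a *: A) => //; rewrite opmulZr opmulZl. Qed.

Lemma corner0 (P' Q' : finop) : corner P' Q' 0.
Proof.
by exists 0 => //; rewrite -(scale0r (0 : finop)) opmulZr opmulZl !scale0r.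
Qed.

(* With the orthogonal projections [P] and [Q] as chosen generators, [T] is
   determined by the map [A |-> A T], being the image of [P]; the operations and
   the norm of the hom-sets are those of the operators [T]. *)
Definition left_rho (T : finop) (hT : corner P Q T) : left_hom M N :=
  rho (proj_idem M) (proj_idem N) (I := left_ideal_proj M)
    (J := left_ideal_proj N) erefl erefl hT.

Definition right_lambda (T : finop) (hT : corner Q P T) : right_hom M N :=
  lambda (proj_idem M) (proj_idem N) (I := right_ideal_proj M)
    (J := right_ideal_proj N) erefl erefl hT.

Lemma proj_left_ideal : P \in left_ideal P.
Proof. by apply/mem_set/left_idealP; exact: proj_idem. Qed.

Lemma proj_right_ideal : P \in right_ideal P.
Proof. by apply/mem_set/right_idealP; exact: proj_idem. Qed.

Definition left_op (f : left_hom M N) : finop :=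
  sval (lhom_fun f (SigSub proj_left_ideal)).

Definition right_op (f : right_hom M N) : finop :=
  sval (rhom_fun f (SigSub proj_right_ideal)).

Lemma left_homE (f : left_hom M N) (A : left_ideal P) :
  sval (lhom_fun f A) = (sval A * left_op f)%g.
Proof.
rewrite /left_op; have [P' [T [Q' [_ _ _ _ fE]]]] := lhom_rho f.
by rewrite !fE /= mulgA (left_idealK (proj_idem M)).
Qed.

Lemma right_homE (f : right_hom M N) (A : right_ideal P) :
  sval (rhom_fun f A) = (right_op f * sval A)%g.
Proof.
rewrite /right_op; have [P' [T [Q' [_ _ _ _ fE]]]] := rhom_lambda f.
by rewrite !fE /= -mulgA (right_idealK (proj_idem M)).
Qed.

Lemma left_op_corner (f : left_hom M N) : corner P Q (left_op f).
Proof.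
apply/cornerP; try exact: proj_idem; split.
  by rewrite -[X in (X * _)%g]/(sval (SigSub proj_left_ideal)) -left_homE.
exact: (left_idealK (proj_idem N)).
Qed.

Lemma right_op_corner (f : right_hom M N) : corner Q P (right_op f).
Proof.
apply/cornerP; try exact: proj_idem; split; last first.
  by rewrite -[X in (_ * X)%g]/(sval (SigSub proj_right_ideal)) -right_homE.
exact: (right_idealK (proj_idem N)).
Qed.

Lemma left_rhoK (T : finop) (hT : corner P Q T) : left_op (left_rho hT) = T.
Proof. exact: ((cornerP _ (proj_idem M) (proj_idem N)).1 hT).1. Qed.

Lemma right_lambdaK (T : finop) (hT : corner Q P T) :
  right_op (right_lambda hT) = T.
Proof. exact: ((cornerP _ (proj_idem N) (proj_idem M)).1 hT).2. Qed.

Lemma left_op_inj : injective left_op.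
Proof. by move=> f g e; apply: lhom_eq => A; rewrite !left_homE e. Qed.

Lemma right_op_inj : injective right_op.
Proof. by move=> f g e; apply: rhom_eq => A; rewrite !right_homE e. Qed.

Definition left_hom0 := left_rho (corner0 P Q).
Definition left_homD f g :=
  left_rho (cornerD (left_op_corner f) (left_op_corner g)).
Definition left_homZ a f := left_rho (cornerZ a (left_op_corner f)).

Definition right_hom0 := right_lambda (corner0 Q P).
Definition right_homD f g :=
  right_lambda (cornerD (right_op_corner f) (right_op_corner g)).
Definition right_homZ a f := right_lambda (cornerZ a (right_op_corner f)).

Definition left_homN f := left_homZ (-1) f.
Definition right_homN f := right_homZ (-1) f.

Fact left_homA : associative left_homD.
Proof. by move=> f g h; apply: left_op_inj; rewrite !left_rhoK addrA. Qed.
Fact left_homC : commutative left_homD.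
Proof. by move=> f g; apply: left_op_inj; rewrite !left_rhoK addrC. Qed.
Fact left_hom0D : left_id left_hom0 left_homD.
Proof. by move=> f; apply: left_op_inj; rewrite !left_rhoK add0r. Qed.
Fact left_homND : left_inverse left_hom0 left_homN left_homD.
Proof.
by move=> f; apply: left_op_inj; rewrite !left_rhoK scaleN1r addNr.
Qed.
HB.instance Definition _ := GRing.isZmodule.Build (left_hom M N)
  left_homA left_homC left_hom0D left_homND.

Fact right_homA : associative right_homD.
Proof. by move=> f g h; apply: right_op_inj; rewrite !right_lambdaK addrA. Qed.
Fact right_homC : commutative right_homD.
Proof. by move=> f g; apply: right_op_inj; rewrite !right_lambdaK addrC. Qed.
Fact right_hom0D : left_id right_hom0 right_homD.
Proof. by move=> f; apply: right_op_inj; rewrite !right_lambdaK add0r. Qed.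
Fact right_homND : left_inverse right_hom0 right_homN right_homD.
Proof.
by move=> f; apply: right_op_inj; rewrite !right_lambdaK scaleN1r addNr.
Qed.
HB.instance Definition _ := GRing.isZmodule.Build (right_hom M N)
  right_homA right_homC right_hom0D right_homND.

Lemma left_opD f g : left_op (f + g) = left_op f + left_op g.
Proof. exact: left_rhoK. Qed.
Lemma left_op_scale a f : left_op (left_homZ a f) = a *: left_op f.
Proof. exact: left_rhoK. Qed.
Lemma right_opD f g : right_op (f + g) = right_op f + right_op g.
Proof. exact: right_lambdaK. Qed.
Lemma right_op_scale a f : right_op (right_homZ a f) = a *: right_op f.
Proof. exact: right_lambdaK. Qed.

Fact left_homZA a b f : left_homZ a (left_homZ b f) = left_homZ (a * b) f.
Proof. by apply: left_op_inj; rewrite !left_op_scale scalerA. Qed.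
Fact left_hom1Z : left_id 1 left_homZ.
Proof. by move=> f; apply: left_op_inj; rewrite left_op_scale scale1r. Qed.
Fact left_homZDr : right_distributive left_homZ +%R.
Proof.
move=> a f g; apply: left_op_inj.
by rewrite !(left_op_scale, left_opD) scalerDr.
Qed.
Fact left_homZDl f : {morph left_homZ^~ f : a b / a + b}.
Proof.
move=> a b; apply: left_op_inj.
by rewrite !(left_op_scale, left_opD) scalerDl.
Qed.
HB.instance Definition _ := GRing.Zmodule_isLmodule.Build K (left_hom M N)
  left_homZA left_hom1Z left_homZDr left_homZDl.

Fact right_homZA a b f : right_homZ a (right_homZ b f) = right_homZ (a * b) f.
Proof. by apply: right_op_inj; rewrite !right_op_scale scalerA. Qed.
Fact right_hom1Z : left_id 1 right_homZ.
Proof. by move=> f; apply: right_op_inj; rewrite right_op_scale scale1r. Qed.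
Fact right_homZDr : right_distributive right_homZ +%R.
Proof.
move=> a f g; apply: right_op_inj.
by rewrite !(right_op_scale, right_opD) scalerDr.
Qed.
Fact right_homZDl f : {morph right_homZ^~ f : a b / a + b}.
Proof.
move=> a b; apply: right_op_inj.
by rewrite !(right_op_scale, right_opD) scalerDl.
Qed.
HB.instance Definition _ := GRing.Zmodule_isLmodule.Build K (right_hom M N)
  right_homZA right_hom1Z right_homZDr right_homZDl.

Lemma left_op_linear : linear left_op.
Proof. by move=> a f g; rewrite left_opD left_op_scale. Qed.
HB.instance Definition _ :=
  GRing.isLinear.Build K (left_hom M N) finop _ left_op left_op_linear.

Lemma right_op_linear : linear right_op.
Proof. by move=> a f g; rewrite right_opD right_op_scale. Qed.
HB.instance Definition _ :=
  GRing.isLinear.Build K (right_hom M N) finop _ right_op right_op_linear.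

Definition left_hom_norm (f : left_hom M N) : R := `|left_op f|.
Definition right_hom_norm (f : right_hom M N) : R := `|right_op f|.

Fact left_hom_normD f g :
  left_hom_norm (f + g) <= left_hom_norm f + left_hom_norm g.
Proof. by rewrite /left_hom_norm raddfD ler_normD. Qed.
Fact left_hom_norm_eq0 f : left_hom_norm f = 0 -> f = 0.
Proof. by move/normr0_eq0 => e; apply: left_op_inj; rewrite e raddf0. Qed.
Fact left_hom_normMn f n : left_hom_norm (f *+ n) = left_hom_norm f *+ n.
Proof. by rewrite /left_hom_norm raddfMn normrMn. Qed.
Fact left_hom_normN f : left_hom_norm (- f) = left_hom_norm f.
Proof. by rewrite /left_hom_norm raddfN normrN. Qed.
HB.instance Definition _ := Num.Zmodule_isNormed.Build R (left_hom M N)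
  left_hom_normD left_hom_norm_eq0 left_hom_normMn left_hom_normN.

Fact right_hom_normD f g :
  right_hom_norm (f + g) <= right_hom_norm f + right_hom_norm g.
Proof. by rewrite /right_hom_norm raddfD ler_normD. Qed.
Fact right_hom_norm_eq0 f : right_hom_norm f = 0 -> f = 0.
Proof. by move/normr0_eq0 => e; apply: right_op_inj; rewrite e raddf0. Qed.
Fact right_hom_normMn f n : right_hom_norm (f *+ n) = right_hom_norm f *+ n.
Proof. by rewrite /right_hom_norm raddfMn normrMn. Qed.
Fact right_hom_normN f : right_hom_norm (- f) = right_hom_norm f.
Proof. by rewrite /right_hom_norm raddfN normrN. Qed.
HB.instance Definition _ := Num.Zmodule_isNormed.Build R (right_hom M N)
  right_hom_normD right_hom_norm_eq0 right_hom_normMn right_hom_normN.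

Lemma left_rhoD S T (hS : corner P Q S) (hT : corner P Q T)
    (hST : corner P Q (S + T)) :
  left_rho hS + left_rho hT = left_rho hST.
Proof. by apply: left_op_inj; rewrite raddfD /= !left_rhoK. Qed.

Lemma left_rhoZ a T (hT : corner P Q T) (haT : corner P Q (a *: T)) :
  a *: left_rho hT = left_rho haT.
Proof. by apply: left_op_inj; rewrite linearZ /= !left_rhoK. Qed.

Lemma left_hom_normZ a (f : left_hom M N) : `|a *: f| = sre `|a| * `|f|.
Proof. by rewrite -opnormZ -linearZ. Qed.

Lemma right_hom_normZ a (f : right_hom M N) : `|a *: f| = sre `|a| * `|f|.
Proof. by rewrite -opnormZ -linearZ. Qed.

Lemma left_rho_norm T (hT : corner P Q T) : `|left_rho hT| = opnorm T.
Proof. by congr opnorm; exact: left_rhoK. Qed.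

Lemma right_lambdaD S T (hS : corner Q P S) (hT : corner Q P T)
    (hST : corner Q P (S + T)) :
  right_lambda hS + right_lambda hT = right_lambda hST.
Proof. by apply: right_op_inj; rewrite raddfD /= !right_lambdaK. Qed.

Lemma right_lambdaZ a T (hT : corner Q P T) (haT : corner Q P (a *: T)) :
  a *: right_lambda hT = right_lambda haT.
Proof. by apply: right_op_inj; rewrite linearZ /= !right_lambdaK. Qed.

Lemma right_lambda_norm T (hT : corner Q P T) : `|right_lambda hT| = opnorm T.
Proof. by congr opnorm; exact: right_lambdaK. Qed.

End HomSpace.

End FiniteRank.

(* Main.v *)
(* Write T' for the adjoint of T. On the finite rank operators, it is an
   involutive anti-automorphism, conjugate-linear and isometric, which fixes the
   orthogonal projections. In any regular semigroup with such an involution,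
   I |-> I' exchanges principal left and right ideals, and f |-> (A |-> f(A')')
   sends the right translation by T to the left translation by T'; this
   preserves inclusions, and the same recipe gives the inverse functor.
   The adjoint of T exists by the Riesz representation theorem, and has finite
   rank: if P is the projection onto the range of T, then T = T P (composing
   from left to right), hence T' = P T'. *)
From HB Require Import structures.
From mathcomp Require Import all_boot all_order all_algebra.
From mathcomp Require Import all_classical all_reals all_analysis.
From mathcomp Require Import complex ring lra.
Require Import Defs.

Set Implicit Arguments.
Unset Strict Implicit.
Unset Printing Implicit Defensive.

Import Order.TTheory GRing.Theory Num.Theory.
Import numFieldNormedType.Exports.

Local Open Scope classical_set_scope.
Local Open Scope ring_scope.

(** * Duality of left and right ideals under an involution of a semigroup *)

Section InvolutiveSemigroup.
Local Open Scope group_scope.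
Variables (S : semigroupType) (star : S -> S).
Hypotheses (starK : involutive star)
  (starM : forall A B, star (A * B) = star B * star A).

Lemma idempotent_star P : idempotent_elt P -> idempotent_elt (star P).
Proof. by move=> hP; rewrite /idempotent_elt -starM hP. Qed.

Lemma corner_star P Q T : corner P Q T -> corner (star Q) (star P) (star T).
Proof. by case=> A _ <-; exists (star A) => //; rewrite !starM mulgA. Qed.

(** As [star] is its own inverse, images under it are preimages, where membership needs no
    witness. *)
Lemma image_starE (X : set S) : star @` X = star @^-1` X.
Proof.
by apply/seteqP; split=> [_ [A XA <-]|A XA]; [rewrite /= starK|exists (star A)].
Qed.

Lemma image_starK (X : set S) : star @` (star @` X) = X.
Proof. by rewrite !image_starE; apply/seteqP; split=> A /=; rewrite starK. Qed.

Lemma star_left_ideal P : star @` left_ideal P = right_ideal (star P).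
Proof.
apply/seteqP; split=> [_ [_ [A _ <-] <-]|_ [A _ <-]].
  by exists (star A); rewrite ?starM.
by exists (star A * P); [exists (star A)|rewrite starM starK].
Qed.

Lemma star_right_ideal P : star @` right_ideal P = left_ideal (star P).
Proof. by rewrite -[P in LHS]starK -star_left_ideal image_starK. Qed.

Lemma star_lideal_principal (I : lideal S) :
  exists P, idempotent_elt P /\ star @` I = right_ideal P.
Proof.
have [P [hP ->]] := lideal_principal I.
by exists (star P); split; [exact: idempotent_star|exact: star_left_ideal].
Qed.

Lemma star_rideal_principal (I : rideal S) :
  exists P, idempotent_elt P /\ star @` I = left_ideal P.
Proof.
have [P [hP ->]] := rideal_principal I.
by exists (star P); split; [exact: idempotent_star|exact: star_right_ideal].
Qed.

Definition star_lideal (I : lideal S) : rideal S :=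
  RIdeal (star_lideal_principal I).

Definition star_rideal (I : rideal S) : lideal S :=
  LIdeal (star_rideal_principal I).

Lemma mem_star (X : set S) (A : S) : A \in X -> star A \in star @` X.
Proof. by rewrite !inE => XA; exists A. Qed.

Lemma mem_starV (X : set S) (A : S) : A \in star @` X -> star A \in X.
Proof. by rewrite !inE image_starE. Qed.

Definition star_elt (X : set S) (A : X) : star @` X :=
  SigSub (mem_star (valP A)).

Definition unstar_elt (X : set S) (A : star @` X) : X :=
  SigSub (mem_starV (valP A)).

(** Conjugating the map itself avoids choosing among the triples [P], [T], [Q], which [lhom_rho]
    only asserts to exist. *)
Definition star_lhom (I J : lideal S) (f : lhom I J) :
  rhom (star_lideal I) (star_lideal J).
Proof.
exists (fun A => star_elt (f (unstar_elt A))).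
have [P [T [Q [[hP hQ] hI hJ hT fE]]]] := lhom_rho f.
exists (star P), (star T), (star Q); split.
- by split; exact: idempotent_star.
- by rewrite /= hI star_left_ideal.
- by rewrite /= hJ star_left_ideal.
- exact: corner_star.
- by move=> A; rewrite /= fE starM /= starK.
Defined.

Definition star_rhom (I J : rideal S) (f : rhom I J) :
  lhom (star_rideal I) (star_rideal J).
Proof.
exists (fun A => star_elt (f (unstar_elt A))).
have [P [T [Q [[hP hQ] hI hJ hT fE]]]] := rhom_lambda f.
exists (star P), (star T), (star Q); split.
- by split; exact: idempotent_star.
- by rewrite /= hI star_right_ideal.
- by rewrite /= hJ star_right_ideal.
- exact: corner_star.
- by move=> A; rewrite /= fE starM /= starK.
Defined.

Lemma star_lhom_id I : star_lhom (lhom_id I) = rhom_id (star_lideal I).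
Proof. by apply: rhom_eq => A; rewrite /= starK. Qed.

Lemma star_rhom_id I : star_rhom (rhom_id I) = lhom_id (star_rideal I).
Proof. by apply: lhom_eq => A; rewrite /= starK. Qed.

Lemma star_eltK (X : set S) : cancel (@star_elt X) (@unstar_elt X).
Proof. by move=> A; apply: val_inj; rewrite /= starK. Qed.

Lemma star_lhom_comp I J K (f : lhom I J) (g : lhom J K) :
  star_lhom (lhom_comp f g) = rhom_comp (star_lhom f) (star_lhom g).
Proof. by apply: rhom_eq => A; rewrite /= star_eltK. Qed.

Lemma star_rhom_comp I J K (f : rhom I J) (g : rhom J K) :
  star_rhom (rhom_comp f g) = lhom_comp (star_rhom f) (star_rhom g).
Proof. by apply: lhom_eq => A; rewrite /= star_eltK. Qed.

Definition star_lfunctor : functor (lideal_category S) (rideal_category S) :=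
  @Functor (lideal_category S) (rideal_category S) star_lideal star_lhom
    star_lhom_id star_lhom_comp.

Definition star_rfunctor : functor (rideal_category S) (lideal_category S) :=
  @Functor (rideal_category S) (lideal_category S) star_rideal star_rhom
    star_rhom_id star_rhom_comp.

(** Elements of [I] and [I'] have different types even when the ideals are provably equal, so they
    are compared through their values in [S]. *)
Lemma lhom_arrow_eq (I J I' J' : lideal_category S)
    (f : hom I J) (g : hom I' J') :
  I = I' -> J = J' ->
  (forall (A : (I : lideal S)) (B : (I' : lideal S)), sval A = sval B ->
     sval ((f : lhom I J) A) = sval ((g : lhom I' J') B)) ->
  arrow f = arrow g.
Proof.
by move=> eI eJ; case: I' / eI g; case: J' / eJ => g e;
  congr arrow; apply: lhom_eq => A; exact: e.
Qed.

Lemma rhom_arrow_eq (I J I' J' : rideal_category S)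
    (f : hom I J) (g : hom I' J') :
  I = I' -> J = J' ->
  (forall (A : (I : rideal S)) (B : (I' : rideal S)), sval A = sval B ->
     sval ((f : rhom I J) A) = sval ((g : rhom I' J') B)) ->
  arrow f = arrow g.
Proof.
by move=> eI eJ; case: I' / eI g; case: J' / eJ => g e;
  congr arrow; apply: rhom_eq => A; exact: e.
Qed.

Lemma star_lidealK : cancel star_lideal star_rideal.
Proof. by move=> I; apply: lideal_eq; exact: image_starK. Qed.

Lemma star_ridealK : cancel star_rideal star_lideal.
Proof. by move=> I; apply: rideal_eq; exact: image_starK. Qed.

Lemma star_lfunctorK : functor_left_inverse star_lfunctor star_rfunctor.
Proof.
move=> I J f; apply: lhom_arrow_eq; try exact: star_lidealK.
move=> A B e; rewrite /= starK; congr (sval ((f : lhom I J) _)).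
by apply: val_inj; rewrite /= starK.
Qed.

Lemma star_rfunctorK : functor_left_inverse star_rfunctor star_lfunctor.
Proof.
move=> I J f; apply: rhom_arrow_eq; try exact: star_ridealK.
move=> A B e; rewrite /= starK; congr (sval ((f : rhom I J) _)).
by apply: val_inj; rewrite /= starK.
Qed.

Hypothesis reg : regular_semigroup S.

Definition star_normalIso :
  normalIso (lideal_normalCategory reg) (rideal_normalCategory reg).
Proof.
apply: (@NormalIso (lideal_normalCategory reg) (rideal_normalCategory reg)
  star_lfunctor star_rfunctor).
(* An inclusion fixes underlying elements, so its conjugate sends [A] to [star (star A)]. *)
- by move=> I J j hj A; rewrite /= hj /= starK.
- by move=> I J j hj A; rewrite /= hj /= starK.
- exact: star_lfunctorK.
- exact: star_rfunctorK.
Defined.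

Lemma star_principal_lideal P (hP : idempotent_elt P) : star P = P ->
  star_lideal (principal_lideal hP) = principal_rideal hP.
Proof. by move=> e; apply: rideal_eq; rewrite /= star_left_ideal e. Qed.

End InvolutiveSemigroup.

(** Transport along equalities of ideals leaves underlying operators alone; this is how the cast in
    the definition of [phi] gets computed. *)
Lemma cast_rhomE (S : semigroupType) (I J I' J' : rideal_category S)
    (eI : I = I') (eJ : J = J') (f : hom I J)
    (A : (I : rideal S)) (B : (I' : rideal S)) : sval A = sval B ->
  sval ((cast_hom eI eJ f : rhom I' J') B) = sval ((f : rhom I J) A).
Proof.
case: I' / eI B; case: J' / eJ => B e /=.
by congr (sval ((f : rhom I J) _)); apply: val_inj.
Qed.

(** * Real values of nonnegative scalars *)

Section Scalars.
Variables (R : realType) (k : scalarKind).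
Local Notation K := (scalarField R k).
Local Notation sre := (@sre R k).

Lemma sre_ge0 (x : K) : 0 <= x -> 0 <= sre x.
Proof. by move=> x0; rewrite -(sre0 R k); exact: ler_sre. Qed.

Lemma ltr_sre_ge0 (x y : K) : 0 <= x -> 0 <= y -> (sre x < sre y) = (x < y).
Proof.
move=> x0 y0; rewrite lt_neqAle ler_sre_ge0 // [RHS]lt_neqAle.
by case: (boolP (x <= y)) => [xy|//]; rewrite !eq_le !ler_sre_ge0.
Qed.

(** Radii of balls and bounds of maps on [H] are elements of [K], so real ones must be lifted. *)
Lemma sre_surj_gt0 (r : R) : 0 < r -> exists2 e : K, 0 < e & sre e = r.
Proof.
by case: k => r0; [exists r|exists (real_complex R r); rewrite // ltcR].
Qed.

End Scalars.

(** * Norm identities and the Riesz representation theorem *)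

Section Hilbert.
Variables (R : realType) (k : scalarKind) (H : hilbertSpace R k).
Local Notation K := (scalarField R k).
Local Notation "''[' x , y ]" := (inner H x y).

(** Norms in [H] lie in [K]; real values give access to infima and linear arithmetic. *)
Definition rnorm (x : H) : R := sre `|x|.

Lemma rnorm_ge0 x : 0 <= rnorm x.
Proof. exact: sre_ge0. Qed.

Lemma rnorm_gt0 x : (0 < rnorm x) = (x != 0).
Proof. by rewrite -(sre0 R k) ltr_sre_ge0 // normr_gt0. Qed.

Lemma rnorm_sqr x : rnorm x ^+ 2 = sre '[x, x].
Proof. by rewrite -inner_norm !expr2 sreM_ge0. Qed.

Lemma rnormZ a x : rnorm (a *: x) = sre `|a| * rnorm x.
Proof. by rewrite /rnorm normrZ sreM_ge0. Qed.

Lemma rnorm_parallelogram x y :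
  rnorm (x + y) ^+ 2 + rnorm (x - y) ^+ 2 = (rnorm x ^+ 2 + rnorm y ^+ 2) *+ 2.
Proof.
rewrite !rnorm_sqr mulr2n -!sreD; congr sre.
rewrite !linearDl /= !linearDr /= !linearNl /= !linearNr /=.
ring.
Qed.

(** The vector on the left is the component of [x] orthogonal to [y]; the factor [rnorm y ^+ 2]
    clears the denominator. *)
Lemma rnorm_pythagoras x y : '[y, y] != 0 ->
  rnorm (x - ('[x, y] / '[y, y]) *: y) ^+ 2 * rnorm y ^+ 2 =
  rnorm x ^+ 2 * rnorm y ^+ 2 - sre `|'[x, y]| ^+ 2.
Proof.
move=> y0; rewrite !rnorm_sqr.
set a := '[x, y] / _; set u := x - _.
have uy : '[u, y] = 0 by rewrite linearBl /= innerZl divfK ?subrr.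
rewrite -!sreM_ge0 ?inner_ge0 // expr2 -sreM_ge0 // -sreN -sreD; congr sre.
rewrite {2}/u linearBr /= innerZr uy mulr0 subr0.
rewrite linearBl /= innerZl mulrBl -expr2 normsM -[in RHS]innerC.
by congr (_ - _); rewrite /a mulrAC divfK.
Qed.

Lemma inner_ext (x y : H) : (forall z, '[z, x] = '[z, y]) -> x = y.
Proof.
move=> e; apply/eqP; rewrite -subr_eq0; apply/eqP/inner_eq0.
by rewrite linearBr /= e subrr.
Qed.

(* The representing vector is proportional to the element of least norm of the
   hyperplane [f = 1], the limit of the filter of its almost-minimizers. *)
Lemma riesz (f : H -> K) (B : R) : 0 < B ->
  (forall a x y, f (a *: x + y) = a * f x + f y) ->
  (forall x, sre `|f x| <= B * rnorm x) ->
  exists w, forall x, f x = '[x, w].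
Proof.
move=> B0 lf fB.
have [f0|/existsNP[u /eqP fu]] := pselect (forall x, f x = 0).
  by exists 0 => x; rewrite f0 linear0r.
have f0 : f 0 = 0 by have := lf (-1) 0 0; rewrite scaler0 addr0 mulN1r addNr.
have fZ a x : f (a *: x) = a * f x by rewrite -[a *: x]addr0 lf f0 addr0.
have fD x y : f (x + y) = f x + f y by rewrite -[x in LHS]scale1r lf mul1r.
have fN x : f (- x) = - f x by rewrite -scaleN1r fZ mulN1r.
pose E := [set rnorm x ^+ 2 | x in [set x | f x = 1]].
have E_inf : has_inf E.
  split; first by exists (rnorm ((f u)^-1 *: u) ^+ 2), ((f u)^-1 *: u) => //=;
    rewrite fZ mulVf.
  by exists 0 => _ [x _ <-]; exact: sqr_ge0.
pose d := inf E.
have dE x : f x = 1 -> d <= rnorm x ^+ 2.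
  by move=> fx; apply: ge_inf; [exact: E_inf.2|exists x].
pose S (e : R) := [set x | f x = 1 /\ rnorm x ^+ 2 < d + e].
have S_ex e : 0 < e -> exists x, S e x.
  by move=> e0; have [_ [x fx <-] xe] := inf_adherent e0 E_inf; exists x.
pose F := filter_from [set e : R | 0 < e] S.
have FF : ProperFilter F.
  apply: filter_from_proper => [|e e0]; last exact: S_ex.
  apply: filter_from_filter; first by exists 1 => /=.
  move=> e e' /= e0 e0'; exists (Order.min e e'); first by rewrite /= lt_min e0.
  move=> x [fx xe]; split; split=> //; apply: (lt_le_trans xe);
    by rewrite lerD2l ge_min lexx ?orbT.
(* The midpoint of [x] and [y] also satisfies [f = 1], so its squared norm is at least [d]; the
   parallelogram law then bounds the distance. *)
have S_diam e x y : S e x -> S e y -> rnorm (x - y) ^+ 2 < e *+ 4.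
  move=> [fx xe] [fy ye].
  have h : d <= rnorm (2^-1 *: (x + y)) ^+ 2.
    by apply: dE; rewrite fZ fD fx fy -(natrD _ 1 1) mulVf ?pnatr_eq0.
  have : rnorm (2 *: (2^-1 *: (x + y))) ^+ 2 + rnorm (x - y) ^+ 2 =
      (rnorm x ^+ 2 + rnorm y ^+ 2) *+ 2.
    by rewrite scalerA divff ?pnatr_eq0 // scale1r rnorm_parallelogram.
  rewrite rnormZ normr_nat sre_nat exprMn; lra.
have F_cauchy : cauchy F.
  apply: cauchy_exP => eps eps0.
  have e0 : 0 < sre eps by rewrite -(sre0 R k) ltr_sre_ge0 // ltW.
  (* With this slack the bound [e *+ 4] of [S_diam] is the square of [sre eps]. *)
  have e1 : 0 < (sre eps / 2) ^+ 2 by rewrite exprn_gt0 // divr_gt0.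
  have [x Sx] := S_ex _ e1; exists x; exists ((sre eps / 2) ^+ 2) => // y Sy.
  rewrite -ball_normE /= -ltr_sre_ge0 ?(ltW eps0) //.
  rewrite -(ltr_pXn2r (n := 2)) ?nnegrE ?(ltW e0) ?rnorm_ge0 //.
  have := S_diam _ _ _ Sx Sy; rewrite /rnorm; lra.
have /cvg_ex[z Fz] : cvg F by exact: cauchy_cvg.
have near_z e r : 0 < e -> 0 < r -> exists2 x, S e x & rnorm (z - x) < r.
  move=> e0 r0; have [eps eps0 epsr] := @sre_surj_gt0 R k r r0.
  have Fb : F (ball z eps) by apply: Fz; exact: nbhsx_ballx.
  have FS : F (S e) by exists e.
  have [x [Sx]] := filter_ex (filterI FS Fb).
  rewrite -ball_normE /= -ltr_sre_ge0 ?(ltW eps0) // epsr.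
  by exists x.
(* Otherwise take [x] with [f x = 1] closer to [z] than the gap divided by [B]: the bound on
   [f (z - x)] is violated. *)
have fz : f z = 1.
  apply/eqP; rewrite -subr_eq0 -normr_le0; apply: contraT => fz.
  have g0 : 0 < sre `|f z - 1|.
    by rewrite -(sre0 R k) ltr_sre_ge0 // lt_neqAle normr_ge0 andbT eq_sym
      normr_eq0 -normr_le0.
  have [x [fx _] xz] := near_z _ _ ltr01 (divr_gt0 g0 B0).
  have := fB (z - x); rewrite fD fN fx.
  by rewrite leNgt mulrC -ltr_pdivlMr // xz.
(* Split [z] as [(z - x) + x] with [x] a near-minimizer at distance below [t]. Subtracting from [x]
   its component along [y] keeps [f = 1], so the squared norm drops by less than [t ^+ 2]; thus both
   inner products with [y] are at most [t * rnorm y]. *)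
have orth y : f y = 0 -> '[z, y] = 0.
  move=> fy; have [->|y0] := eqVneq y 0; first exact: linear0r.
  have yy : '[y, y] != 0 by apply: contra_neq y0; exact: inner_eq0.
  have ny : 0 < rnorm y by rewrite rnorm_gt0.
  have le t : 0 < t -> sre `|'[z, y]| <= t * rnorm y *+ 2.
    move=> t0; have [x [fx xe] xz] := near_z _ _ (exprn_gt0 2 t0) t0.
    rewrite -[z](subrK x) linearDl /=; apply: le_trans (ler_sre (ler_normD _ _)) _.
    rewrite sreD mulr2n; apply: lerD.
      apply: le_trans (ler_sre (CauchySchwarz _ _)) _; rewrite sreM_ge0 //.
      by apply: ler_wpM2r; [exact: rnorm_ge0|exact: ltW].
    rewrite -(ler_pXn2r (n := 2)) ?nnegrE ?sre_ge0 ?mulr_ge0 ?rnorm_ge0 ?(ltW t0) //.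
    have := rnorm_pythagoras x yy; set v := x - _ => e.
    have /dE dv : f v = 1 by rewrite fD fN fZ fy mulr0 subr0.
    have y2 : 0 <= rnorm y ^+ 2 by exact: sqr_ge0.
    have : 0 <= (t ^+ 2 - (rnorm x ^+ 2 - rnorm v ^+ 2)) * rnorm y ^+ 2.
      by apply: mulr_ge0 => //; lra.
    rewrite exprMn; lra.
  apply/eqP; rewrite -normr_le0 -(ler_sre_ge0 (k := k)) // sre0.
  rewrite leNgt; apply/negP => c0.
  (* For [t] equal to [c / (3 * rnorm y)], where [c] is the value assumed positive, [le] gives [c]
     at most two thirds of [c]. *)
  have := le _ (divr_gt0 c0 (mulr_gt0 (ltr0n R 3) ny)).
  by rewrite invfM mulrA divfK ?gt_eqF //; lra.
have zz : '[z, z] != 0.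
  apply: contra_eq_neq fz => /inner_eq0 ->.
  by rewrite f0 eq_sym oner_eq0.
(* The conjugate offsets conjugate-linearity in the second argument. Since [x - f x *: z] lies in
   the kernel of [f], it is orthogonal to [z]. *)
exists (sconj '[z, z]^-1 *: z) => x; rewrite innerZr sconjK.
apply: (mulfI zz); rewrite mulrA divff // mul1r.
have : '[x - f x *: z, z] = 0.
  by rewrite innerC orth ?rmorph0 // fD fN fZ fz mulr1 subrr.
by rewrite linearBl /= innerZl => /subr0_eq ->; rewrite mulrC.
Qed.

(** * Adjoints of finite rank operators *)

Lemma opnorm_ge0 (T : finop H) : 0 <= opnorm T.
Proof. exact: (@normr_ge0 R (finop H) T). Qed.

Lemma finop_rnorm (T : finop H) x : rnorm (T x) <= opnorm T * rnorm x.
Proof.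
have [->|x0] := eqVneq x 0.
  by rewrite linear0 /rnorm normr0 sre0 mulr0.
have nx : `|x| != 0 by rewrite normr_eq0.
have := @opnorm_ub _ _ _ T (`|x|^-1 *: x).
rewrite normrZ normfV normr_id mulVf // => /(_ (lexx _)) h.
have -> : T x = `|x| *: T (`|x|^-1 *: x) by rewrite linearZ /= scalerA divff // scale1r.
by rewrite rnormZ normr_id mulrC; apply: ler_wpM2r => //; exact: rnorm_ge0.
Qed.

(** Stated for plain functions, so that it applies before [U] is known to be linear, continuous or
    of finite rank. *)
Definition is_adjoint (T U : H -> H) := forall x y, '[T x, y] = '[x, U y].

(** The squared norm of [U y] is ['[T (U y), y]]; apply Cauchy-Schwarz and cancel one factor
    [rnorm (U y)]. *)
Lemma rnorm_adjoint (T : finop H) (U : H -> H) y : is_adjoint T U ->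
  rnorm (U y) <= opnorm T * rnorm y.
Proof.
move=> UE; have [U0|U0] := eqVneq (U y) 0.
  by rewrite {1}U0 /rnorm normr0 sre0 mulr_ge0 ?opnorm_ge0 ?rnorm_ge0.
have n0 : 0 < rnorm (U y) by rewrite rnorm_gt0.
rewrite -(ler_pM2l n0) -expr2 rnorm_sqr -UE.
apply: le_trans (_ : sre `|'[T (U y), y]| <= _).
  by rewrite UE ger0_norm ?inner_ge0.
apply: le_trans (ler_sre (CauchySchwarz _ _)) _; rewrite sreM_ge0 // mulrA.
apply: ler_wpM2r; first exact: rnorm_ge0.
by rewrite mulrC; exact: finop_rnorm.
Qed.

Lemma span_map (f : H -> H) s x : linear f -> span s x -> span (map f s) (f x).
Proof.
move=> lf; elim: s x => [|v s IH] x.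
  by rewrite !span_nil => ->; have := lf (-1) 0 0;
    rewrite scaler0 addr0 scaleN1r addNr.
move=> /span_cons[a [y [sy ->]]]; apply/span_cons.
by exists a, (f y); rewrite lf; split=> //; exact: IH.
Qed.

(** As [x - P x] is orthogonal to [P y], ['[x, P y]] equals ['[P x, P y]], which is Hermitian in [x]
    and [y]. *)
Lemma orthogonal_projection_adjoint (M : set H) (P : finop H) :
  orthogonal_projection M P -> is_adjoint P P.
Proof.
move=> hP.
have h x y : '[x, P y] = '[P x, P y].
  by apply/eqP; rewrite -subr_eq0 -linearBl /=; apply/eqP/(hP x).2; exact: (hP y).1.
by move=> x y; rewrite h innerC h -innerC.
Qed.

Lemma adjoint_exists (T : finop H) : exists U : finop H, is_adjoint T U.
Proof.
have opT := opnorm_ge0 T.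
have ex y : exists w, forall x, '[T x, y] = '[x, w].
  (* The [+ 1] makes the bound positive even when [T] or [y] vanishes. *)
  apply: (@riesz _ (opnorm T * rnorm y + 1)).
  - by rewrite ltr_wpDl // mulr_ge0 // rnorm_ge0.
  - by move=> a u v; rewrite linearP linearPl.
  - move=> x; apply: le_trans (ler_sre (CauchySchwarz _ _)) _.
    rewrite sreM_ge0 //; have := finop_rnorm T x.
    have := rnorm_ge0 x; have := rnorm_ge0 y; rewrite -/(rnorm _) -/(rnorm _); nra.
have [U UE] := choice ex.
have lU : linear U.
  move=> a x y; apply: inner_ext => z.
  by rewrite -UE linearDr /= linearDr /= !innerZr !UE.
have nU y := rnorm_adjoint y (fun x z => UE z x).
have cU : continuous U.
  pose f : {linear H -> H} := HB.pack U (GRing.isLinear.Build K H H _ U lU).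
  apply: (@bounded_linear_continuous _ _ _ f); apply/bounded_funP => r.
  have [b b0 bE] := @sre_surj_gt0 R k (opnorm T + 1) (ltr_wpDl opT ltr01).
  exists (b * r) => x xr; apply: le_trans (_ : b * `|x| <= _).
    rewrite -(ler_sre_ge0 (k := k)) ?mulr_ge0 ?(ltW b0) // sreM_ge0 ?(ltW b0) //.
    rewrite bE; apply: le_trans (nU x) _; apply: ler_wpM2r; first exact: rnorm_ge0.
    by rewrite lerDl.
  by apply: ler_wpM2l => //; exact: ltW.
have [_ _ fT] := finopP T; have [s sE] := fT.
have [P] := orthogonal_projection_exists (FdSubspace fT).
rewrite /= sE => hP.
(* [P] is self-adjoint and fixes the range of [T]. Hence the range of [U] lies in the span of the
   images of [s]. *)
have UP y : U y = U (P y).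
  apply: inner_ext => x; rewrite -!UE.
  rewrite -(orthogonal_projection_adjoint hP).
  by rewrite (orthogonal_projection_fix hP) // -sE; exists x.
have rU : U \in @finite_rank R k H.
  apply: (@finite_rankP _ _ _ _ (map U s)) => // _ [y _ <-].
  by rewrite UP; apply: (span_map lU); exact: (hP y).1.
by exists (FinOp rU) => x y; exact: UE.
Qed.

Definition adjoint (T : finop H) : finop H := projT1 (cid (adjoint_exists T)).

Lemma adjointP (T : finop H) : is_adjoint T (adjoint T).
Proof. exact: projT2 (cid (adjoint_exists T)). Qed.

(** Inner products separate vectors; the algebraic identities for [adjoint] thus reduce to checking
    [is_adjoint]. *)
Lemma adjoint_unique (T U : finop H) : is_adjoint T U -> adjoint T = U.
Proof.
move=> TU; apply: finop_eq => y; apply: inner_ext => x.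
by rewrite -adjointP TU.
Qed.

Lemma adjointK : involutive adjoint.
Proof.
move=> T; apply: adjoint_unique => x y.
by rewrite innerC -adjointP -innerC.
Qed.

Lemma adjointM (S T : finop H) :
  adjoint (S * T)%g = (adjoint T * adjoint S)%g.
Proof. by apply: adjoint_unique => x y /=; rewrite !adjointP. Qed.

Lemma adjoint_conj_linear a (S T : finop H) :
  adjoint (a *: S + T) = sconj a *: adjoint S + adjoint T.
Proof.
apply: adjoint_unique => x y.
have -> : (a *: S + T) x = a *: S x + T x by [].
have -> : (sconj a *: adjoint S + adjoint T) y =
  sconj a *: adjoint S y + adjoint T y by [].
by rewrite linearPl linearDr /= innerZr sconjK !adjointP.
Qed.

Lemma adjoint_proj (M : fdSubspace H) : adjoint (proj M) = proj M.
Proof. exact/adjoint_unique/orthogonal_projection_adjoint/projP. Qed.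

(** By [adjointK], one inequality, used for [T] and for [adjoint T], suffices. *)
Lemma opnorm_adjoint T : opnorm (adjoint T) = opnorm T.
Proof.
have le U : opnorm (adjoint U) <= opnorm U.
  apply: opnorm_le => y y1; apply: le_trans (rnorm_adjoint y (adjointP U)) _.
  rewrite -[leRHS]mulr1; apply: ler_wpM2l; first exact: opnorm_ge0.
  by rewrite -(sre1 R k); exact: ler_sre.
by apply/eqP; rewrite eq_le le -{1}[T]adjointK le.
Qed.

End Hilbert.

Theorem theorem4p4 (R : realType) (k : scalarKind) (H : hilbertSpace R k) :
  exists (Phi : normalIso (left_ideals H) (right_ideals H))
         (PhiE : forall M : fdSubspace H,
            Phi (left_ideal_proj M) = right_ideal_proj M),
  forall M N : fdSubspace H,
    let phi (f : left_hom M N) : right_hom M N :=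
      cast_hom (PhiE M) (PhiE N) (functor_hom Phi f) in
    [/\ forall (a : scalarField R k) (f g : left_hom M N),
          phi (a *: f + g) = sconj a *: phi f + phi g,
        forall f : left_hom M N, `|phi f| = `|f|
      & bijective phi].
Proof.
exists (star_normalIso (@adjointK _ _ H) (@adjointM _ _ H) (@finop_regular _ _ H)).
exists (fun M => star_principal_lideal (@adjointK _ _ H) (@adjointM _ _ H)
  (proj_idem M) (adjoint_proj M)).
move=> M N phi.
(* In terms of the representing operators, [phi] is the adjoint; all three claims follow from
   this. *)
have phiE f : right_op (phi f) = adjoint (left_op f).
  (* [A] is [proj M] viewed in the image of the left ideal, where [phi] can be evaluated without the
     cast. *)
  pose A : star_lideal (@adjointK _ _ H) (@adjointM _ _ H) (left_ideal_proj M) :=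
    star_elt (@adjoint _ _ H) (SigSub (proj_left_ideal M)).
  rewrite /right_op /phi (@cast_rhomE _ _ _ _ _ _ _ _ A) /=; last first.
    by rewrite adjoint_proj.
  by congr (adjoint (sval (lhom_fun f _))); apply: val_inj; rewrite /= adjointK.
split.
- move=> a f g; apply: right_op_inj.
  by rewrite linearP /= !phiE linearP adjoint_conj_linear.
- by move=> f; rewrite -[LHS]/(opnorm _) phiE opnorm_adjoint.
- have c (g : right_hom M N) : corner (proj M) (proj N) (adjoint (right_op g)).
    have := corner_star (@adjointM _ _ H) (right_op_corner g).
    by rewrite !adjoint_proj.
  exists (fun g => left_rho (c g)) => [f|g].
    by apply: left_op_inj; rewrite left_rhoK phiE adjointK.
  by apply: right_op_inj; rewrite phiE left_rhoK adjointK.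
Qed.
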